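(* Let $G$ be an Eulerian ribbon graph and $T$ a spanning tree of $G$. For $A\subseteq E(G)$, write $A\cap E(T)=\{e_1,\dots,e_s\}$. Then the partial Petrial $G^{\tau(A)}$ is checkerboard colourable if and only if $$A=A_0\,\Delta\,E_{e_1}\,\Delta\cdots\Delta\,E_{e_s},$$ where $A_0=\{e\in E(G)\setminus E(T)\mid t(e,G/E(T))=1\}$, $E_{e_i}$ is the adjoint set of $e_i$ (with respect to $T$), and $\Delta$ denotes symmetric difference.
   Context: A ribbon graph $G=(V(G),E(G))$ is a (possibly non-orientable) surface with boundary written as a union of vertex discs and edge discs meeting in disjoint line segments (common line segments), each lying on exactly one vertex and one edge, each edge containing exactly two of them. The two arcs of the boundary of an edge disc other than its common line segments are its edge line segments; the arcs of the boundary of a vertex disc other than common line segments are vertex line segments. The degree of a vertex is the number of common line segments on it; $G$ is Eulerian if every vertex has even degree. $G$ is checkerboard colourable if its boundary components can be coloured black and white so that the two edge line segments of each edge receive different colours. Arrow presentation: circles (vertex boundaries) carrying, for each edge $e$, two marking arrows labelled $e$ on the common line segments of $e$; the ribbon graph is recovered by filling the circles with discs and attaching, for each $e$, an edge disc along the two $e$-arrows so that their directions agree along the edge. Around each circle, marking arrows and vertex line segments alternate. Partial Petrial $G^{\tau(A)}$: reverse the direction of exactly one of the two arrows of each $e\in A$. Partial dual $G^{\delta(A)}$: for each $e\in A$ with arrows $e',e''$, draw a segment directed from the head of $e'$ to the tail of $e''$ and one from the head of $e''$ to the tail of $e'$, both labelled $e$, and delete the arcs carrying $e',e''$. Contraction: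 $G/A=G^{\delta(A)}-A$ (delete the edges of $A$). Edges are identified across these operations. For a spanning tree $T$, $G^{\delta(E(T))}$ and $G/E(T)$ are bouquets. Index: for $e\in E(G)\setminus E(T)$ with marking arrows $e',e''$ on the circle of the arrow presentation of $G/E(T)$, set $t(e,G/E(T))=0$ if the number of vertex line segments met when going along the circle from the vertex line segment at the head of $e'$ to the vertex line segment at the tail of $e''$ (both included) is odd, and $t(e,G/E(T))=1$ otherwise. Adjoint set: consider the arrow presentation of the bouquet $G^{\delta(E(T))}$ (a single circle carrying the marking arrows of all edges). For $e\in E(T)$, its two marking arrows cut the circle into two arcs; choose one, $P_e$. Then $E_e=\{e\}\cup\{f\in E(G)\setminus E(T)\mid \text{exactly one marking arrow of } f \text{ lies on } P_e\}$. *)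

(* Defs.v *)
From HB Require Import structures.
From mathcomp Require Import all_boot.

Set Implicit Arguments.
Unset Strict Implicit.
Unset Printing Implicit Defensive.

(* Ribbon graphs are given by their arrow presentations. The two marking      *)
(* arrows of an edge e are (e, false) and (e, true); the two ends of an arrow *)
(* m, which are the points where its common line segment meets the vertex     *)
(* line segments, are its tail (m, false) and its head (m, true).             *)
Definition arrow (E : finType) : finType := (E * bool)%type.
Definition aend (E : finType) : finType := (arrow E * bool)%type.

Section Ends.
Variable E : finType.
Implicit Types (m : arrow E) (x : aend E).

Definition tail m : aend E := (m, false).
Definition head m : aend E := (m, true).
Definition label x : E := x.1.1.

(* The other end of the same arrow (common line segment). *)
Definition across x : aend E := let: (m, h) := x in (m, ~~ h).

(* The other end of the same edge line segment: as the directions of the two  *)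
(* arrows agree along the edge disc, the edge line segments of e go from the  *)
(* head of each arrow of e to the tail of the other one.                      *)
Definition along_edge x : aend E := let: ((e, b), h) := x in ((e, ~~ b), ~~ h).

Lemma acrossK : involutive across.
Proof. by case=> m []. Qed.

Lemma along_edgeK : involutive along_edge.
Proof. by move=> [[e []] []]. Qed.

Lemma label_across x : label (across x) = label x.
Proof. by case: x. Qed.

Lemma across_neq x : across x != x.
Proof. by case: x => m []; apply/eqP=> -[]. Qed.

End Ends.

(* A ribbon graph whose edges carry labels in E. On the ends of the arrows of *)
(* the graph, vls is the fixed-point free involution exchanging the two end   *)
(* points of each vertex line segment; it is the identity on unused labels.   *)
(* The circles without marking arrows (isolated vertices) are only counted,   *)
(* by blanks.                                                                 *)
Record ribbon_graph (E : finType) := RibbonGraph {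
  edges : {set E};
  vls : aend E -> aend E;
  blanks : nat;
  vlsK : involutive vls;
  vls_fix : forall x, (vls x == x) = (label x \notin edges)
}.

Section RibbonGraph.
Variable E : finType.
Implicit Types (G : ribbon_graph E) (T A : {set E}) (e : E) (x : aend E).

(* The closed curve through x formed by the vertex line segments and the      *)
(* segments joining y to s y, as the set of arrow ends on it. It is a vertex  *)
(* boundary for s := across, and a boundary component of the surface for      *)
(* s := along_edge.                                                           *)
Definition curve G (s : aend E -> aend E) x : {set aend E} :=
  [set y | connect [rel y z | (z == vls G y) || (z == s y)] x y].

(* All such curves; an arrowless circle inr i is both a vertex boundary and a *)
(* boundary component.                                                        *)
Definition curves G (s : aend E -> aend E) : {set {set aend E} + 'I_(blanks G)} :=
  [set inl (curve G s x) | x : aend E & label x \in edges G]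
    :|: [set inr i | i : 'I_(blanks G)].

Definition vertices G := curves G (@across E).
Definition boundary_components G := curves G (@along_edge E).

Definition vertex_of G (m : arrow E) : {set aend E} + 'I_(blanks G) :=
  inl (curve G (@across E) (tail m)).

(* The boundary component containing the edge line segment that starts at the *)
(* head of m (and ends at the tail of the other arrow with the same label).   *)
Definition boundary_of G (m : arrow E) : {set aend E} + 'I_(blanks G) :=
  inl (curve G (@along_edge E) (head m)).

Definition degree G (u : {set aend E} + 'I_(blanks G)) : nat :=
  #|[set m : arrow E | (m.1 \in edges G) && (vertex_of G m == u)]|.

Definition eulerian G : Prop := {in vertices G, forall u, ~~ odd (degree u)}.

Definition checkerboard_colourable G : Prop :=
  exists black : {set {set aend E} + 'I_(blanks G)},
    black \subset boundary_components G /\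
    {in edges G, forall e,
      (boundary_of G (e, false) \in black) != (boundary_of G (e, true) \in black)}.

(* Spanning subgraphs are represented by their edge sets. An arrow m = (e, b) *)
(* also stands for e oriented from the vertex of (e, b) to that of (e, ~~ b). *)
Definition target_of G (m : arrow E) : {set aend E} + 'I_(blanks G) :=
  vertex_of G (m.1, ~~ m.2).

Definition spanning_connected G T : Prop :=
  vertices G != set0 /\
  {in vertices G &, forall u w,
    connect [rel u w | [exists m : arrow E,
      [&& m.1 \in T, vertex_of G m == u & target_of G m == w]]] u w}.

Definition is_graph_cycle G T (p : seq (arrow E)) : bool :=
  [&& p != [::], all (fun m => m.1 \in T) p,
      cycle [rel m m' | target_of G m == vertex_of G m'] p,
      uniq (map fst p) & uniq (map (vertex_of G) p)].

Definition spanning_tree G T : Prop :=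
  [/\ T \subset edges G, spanning_connected G T
    & forall p : seq (arrow E), ~~ is_graph_cycle G T p].

End RibbonGraph.

Section Relocate.
Variables (E : finType) (f g : aend E -> aend E).
Hypotheses (fK : cancel f g) (gK : cancel g f).
Hypothesis label_f : forall x, label (f x) = label x.
Variable G : ribbon_graph E.

Let vls' x := g (vls G (f x)).

Fact relocateK : involutive vls'.
Proof. by move=> x; rewrite /vls' gK vlsK fK. Qed.

Fact relocate_fix x : (vls' x == x) = (label x \notin edges G).
Proof. by rewrite /vls' (can2_eq gK fK) vls_fix label_f. Qed.

(* Redrawing the arrows: the end x of the new arrows is placed at the point   *)
(* which was the end f x of the old ones. The vertex line segments are kept.  *)
Definition relocate : ribbon_graph E :=
  @RibbonGraph E (edges G) vls' (blanks G) relocateK relocate_fix.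

End Relocate.

Section Operations.
Variable E : finType.
Implicit Types (A : {set E}) (x : aend E).

Definition petrial_place A x : aend E :=
  let: ((e, b), h) := x in ((e, b), if (e \in A) && b then ~~ h else h).

Fact petrial_placeK A : involutive (petrial_place A).
Proof. by move=> [[e b] h] /=; case: (_ && _); rewrite ?negbK. Qed.

Fact label_petrial_place A x : label (petrial_place A x) = label x.
Proof. by case: x => [[e b] h]. Qed.

Definition partial_petrial (G : ribbon_graph E) A : ribbon_graph E :=
  relocate (petrial_placeK A) (petrial_placeK A) (@label_petrial_place A) G.

(* The new arrow (e, b) goes from the old head of (e, b) to the old tail of   *)
(* (e, ~~ b).                                                                 *)
Definition dual_place A x : aend E :=
  let: ((e, b), h) := x in
  if e \in A then (if h then tail (e, ~~ b) else head (e, b)) else x.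

Definition dual_unplace A x : aend E :=
  let: ((e, b), h) := x in
  if e \in A then (if h then tail (e, b) else head (e, ~~ b)) else x.

Fact dual_placeK A : cancel (dual_place A) (dual_unplace A).
Proof.
by move=> [[e b] h] /=; case: (boolP (e \in A)) => eA; case: h => /=;
   rewrite ?eA ?(negbTE eA) ?negbK.
Qed.

Fact dual_unplaceK A : cancel (dual_unplace A) (dual_place A).
Proof.
by move=> [[e b] h] /=; case: (boolP (e \in A)) => eA; case: h => /=;
   rewrite ?eA ?(negbTE eA) ?negbK.
Qed.

Fact label_dual_place A x : label (dual_place A x) = label x.
Proof. by case: x => [[e b] h] /=; case: ifP => //; case: h. Qed.

Definition partial_dual (G : ribbon_graph E) A : ribbon_graph E :=
  relocate (@dual_placeK A) (@dual_unplaceK A) (@label_dual_place A) G.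

End Operations.

Section Deletion.
Variables (E : finType) (G : ribbon_graph E) (A : {set E}).
Implicit Types x y z : aend E.

Let v := vls G.
Let a := @across E.
Let g y := v (a y).
Let r y := a (v y).

(* Erasing the arrows labelled in A merges vertex line segments: from x, move *)
(* along the circle, passing over every arrow with a label in A, until the    *)
(* first end of a remaining arrow; this takes fewer than #|aend E| steps.     *)
Definition skip y : aend E := if label y \in A then vls G (across y) else y.
Definition delete_vls x : aend E :=
  if label x \in A then x else iter #|aend E| skip (vls G x).

Let g_inj : injective g.
Proof. by move=> y z /(inv_inj (@vlsK E G)) /(inv_inj (@acrossK E)). Qed.

Let first_exit x :
  label x \notin A ->
  exists n, [/\ n < #|aend E|, label (iter n g (v x)) \notin A
              & forall i, i < n -> label (iter i g (v x)) \in A].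
Proof.
move=> xA.
have /iter_findex con : fconnect g (v x) (a x).
  rewrite fconnect_sym //; apply: (@connect1 _ (frel g)) => /=.
  by rewrite /g /a acrossK.
have lt : findex g (v x) (a x) < #|aend E|.
  apply: leq_trans (max_card (fconnect g (v x))).
  apply: findex_max; rewrite fconnect_sym //.
  by apply: (@connect1 _ (frel g)) => /=; rewrite /g /a acrossK.
have ex : exists n, label (iter n g (v x)) \notin A.
  by exists (findex g (v x) (a x)); rewrite con label_across.
exists (ex_minn ex); case: ex_minnP => n nA nmin; split=> //.
  by apply: leq_ltn_trans lt; apply: nmin; rewrite con label_across.
by move=> i; apply: contraTT => /nmin; rewrite -leqNgt.
Qed.

Let iter_skip y n N :
    n <= N -> label (iter n g y) \notin A ->
    (forall i, i < n -> label (iter i g y) \in A) ->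
  iter N skip y = iter n g y.
Proof.
move=> le_nN nA inA; rewrite -(subnK le_nN) iterD.
have -> : iter n skip y = iter n g y.
  elim: n {le_nN nA} inA => //= n IH inA.
  rewrite IH => [|i lt_in]; first by rewrite {1}/skip inA.
  by apply: inA; apply: ltnW.
by elim: (N - n) => //= k ->; rewrite /skip (negbTE nA).
Qed.

Let back i y : v (iter i g y) = iter i r (v y).
Proof. by elim: i => //= i <-; rewrite /g /r /v !vlsK. Qed.

Let iter_ag i y : iter i g (iter i r y) = y.
Proof.
elim: i y => // i IH y; rewrite iterSr iterS.
by rewrite [g (r _)](_ : _ = iter i r y) ?IH // /g /r /a acrossK /v vlsK.
Qed.

Let reverse n i y : i <= n -> iter i g (v (iter n g y)) = v (iter (n - i) g y).
Proof. by move=> le; rewrite -{1}(subnKC le) iterD back iter_ag. Qed.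

Fact delete_vlsK : involutive delete_vls.
Proof.
move=> x; rewrite {2}/delete_vls; case: ifPn => xA; first by rewrite /delete_vls xA.
have [n [ltn nA inA]] := first_exit xA.
rewrite (iter_skip (ltnW ltn) nA inA) /delete_vls (negbTE nA).
rewrite -/v (@iter_skip _ n) ?(ltnW ltn) //.
- by rewrite reverse // subnn /= /v vlsK.
- by rewrite reverse // subnn /= /v vlsK.
move=> i lt_in; rewrite reverse 1?ltnW //.
have -> : n - i = (n - i.+1).+1 by rewrite subnSK.
rewrite iterS /g /v vlsK label_across inA // ltn_subrL /=.
by case: (n) lt_in.
Qed.

Fact delete_vls_fix x : (delete_vls x == x) = (label x \notin edges G :\: A).
Proof.
rewrite inE negb_and negbK /delete_vls; case: ifPn => xA /=; first by rewrite eqxx.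
have fixed y : label y \notin edges G -> v y = y.
  by move=> yG; apply/eqP; rewrite /v vls_fix.
case: (boolP (label x \in edges G)) => [xG | /fixed vx]; last first.
  rewrite -/v vx; apply/eqP; elim: #|_| => //= n ->.
  by rewrite /skip (negbTE xA).
have [n [ltn nA inA]] := first_exit xA.
rewrite (iter_skip (ltnW ltn) nA inA); apply/negbTE/eqP => cyc.
suff : forall k y, label y \in edges G -> iter k g (v y) <> y.
  by move/(_ n x xG).
have vG y : label y \in edges G -> v y <> y.
  by move=> yG; apply/eqP; rewrite /v vls_fix yG.
have rG y : label y \in edges G -> label (r y) \in edges G.
  move=> yG; rewrite /r label_across; apply: contraTT yG => /fixed.
  by rewrite {1}/v vlsK => yv; rewrite -vls_fix -/v -yv.
move=> k; have [m] := ubnP k; elim: m k => // m IH [|[|k]] lt_km y yG.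
- exact: vG.
- by rewrite /= => /(congr1 v) /eqP; rewrite /g /v vlsK (negbTE (across_neq _)).
rewrite iterSr iterS => /(congr1 r).
have rg z : r (g z) = z by rewrite /g /r /v vlsK /a acrossK.
by rewrite rg; apply: IH; [rewrite -ltnS; apply: ltnW | apply: rG].
Qed.

(* Circles all of whose arrows are erased become arrowless. *)
Definition delete : ribbon_graph E :=
  @RibbonGraph E (edges G :\: A) delete_vls
    (blanks G + #|[set curve G (@across E) x | x : aend E &
        (label x \in edges G) && [forall y in curve G (@across E) x, label y \in A]]|)
    delete_vlsK delete_vls_fix.

End Deletion.

Definition contraction (E : finType) (G : ribbon_graph E) (A : {set E}) :
  ribbon_graph E := delete (partial_dual G A) A.

Section IndexAdjoint.
Variable E : finType.
Implicit Types (G : ribbon_graph E) (T : {set E}) (e f : E) (x : aend E).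

(* Going once around a circle, starting by leaving an arrow at its end x: the *)
(* end at which each successive arrow is left. From the end y of this list    *)
(* one follows the vertex line segment joining y to vls G y.                  *)
Definition walk G x : seq (aend E) := orbit (fun y => across (vls G y)) x.

(* The number of vertex line segments met from the one at the head of         *)
(* e' = (e, true) to the one at the tail of e'' = (e, false), both included.  *)
Definition segments_met G e : nat :=
  (find (fun y => (y == tail (e, false)) || (vls G y == tail (e, false)))
     (walk G (head (e, true)))).+1.

Definition index_t G e : nat := if odd (segments_met G e) then 0 else 1.

(* The arrows on one of the two arcs into which the arrows labelled e cut the *)
(* circle of a bouquet, namely the arc leaving (e, true) at its head if h and *)
(* at its tail otherwise.                                                     *)
Definition arc_arrows G e (h : bool) : seq (arrow E) :=
  let w := behead (walk G ((e, true), h)) in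
  [seq y.1 | y <- take (find (fun y => label y == e) w) w].

Definition adjoint_set G T (h : bool) e : {set E} :=
  let P := arc_arrows (partial_dual G T) e h in
  e |: [set f in edges G :\: T | ((f, false) \in P) != ((f, true) \in P)].

Definition index_one_set G T : {set E} :=
  [set e in edges G :\: T | index_t (contraction G T) e == 1].

End IndexAdjoint.

Definition symdiff (E : finType) (A B : {set E}) : {set E} :=
  (A :\: B) :|: (B :\: A).

Section Symdiff.
Variable E : finType.
Implicit Types A B : {set E}.

Lemma in_symdiff A B e : (e \in symdiff A B) = (e \in A) (+) (e \in B).
Proof. by rewrite !inE; case: (e \in A); case: (e \in B). Qed.

Fact symdiffA : associative (@symdiff E).
Proof. by move=> A B C; apply/setP=> e; rewrite !in_symdiff addbA. Qed.

Fact symdiffC : commutative (@symdiff E).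
Proof. by move=> A B; apply/setP=> e; rewrite !in_symdiff addbC. Qed.

Fact symdiff0 : left_id set0 (@symdiff E).
Proof. by move=> A; apply/setP=> e; rewrite in_symdiff inE. Qed.

HB.instance Definition _ :=
  Monoid.isComLaw.Build {set E} set0 (@symdiff E) symdiffA symdiffC symdiff0.

End Symdiff.

(* Main.v *)
(* Carried back to G, a checkerboard colouring of the partial Petrial on A is a
   two-colouring c of the vertex line segments of G that alternates around every
   vertex boundary and takes different values at the two ends of an edge line
   segment of e exactly when e is in A. As G is Eulerian, alternating colourings
   exist, and two of them differ by a two-colouring of the vertices. Since T is a
   spanning tree, the trace of A on T can therefore be prescribed and determines
   A. Swapping the colours on one side of a tree edge e changes A by the adjoint
   set of e: both arise from the two arcs into which e cuts the single circle of
   the partial dual. The colouring whose trace on T is empty alternates along the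
   circle of the contraction, so its set A is read off the parities t(e). *)
Require Import Defs.
From mathcomp Require Import all_boot.
Import Defs. (* [head] is that of an arrow, not of a sequence *)

Set Implicit Arguments.
Unset Strict Implicit.
Unset Printing Implicit Defensive.

(** * Parity of finite sets carrying involutions *)

Lemma even_card_involution (X : finType) (f : X -> X) (C : {set X}) :
    {in C, forall x, [/\ f x \in C, f (f x) = x & f x != x]} ->
  ~~ odd #|C|.
Proof.
have [n] := ubnP #|C|; elim: n C => // n IH C ltCn fC.
have [-> | [x xC]] := set_0Vmem C; first by rewrite cards0.
have [fxC ffx fx_neq] := fC x xC.
rewrite (cardsD1 x) xC (cardsD1 (f x)) !inE fx_neq fxC /= negbK.
apply: IH => [|y].
  by move: ltCn; rewrite (cardsD1 x) xC (cardsD1 (f x)) !inE fx_neq fxC /= => /ltnW.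
rewrite !inE => /and3P[y_neq1 y_neq2 yC]; have [fyC ffy fy_neq] := fC y yC.
split=> //; rewrite fyC andbT; apply/andP; split.
  by apply: contra_neq y_neq2 => fyfx; rewrite -ffy fyfx ffx.
by apply: contra_neq y_neq1 => fyx; rewrite -ffy fyx.
Qed.

(** Meant for a component [C] of a graph joining each x to [f x] and, off [B], also to [g x]: both
    [C] and [C :\: B] split into pairs. *)
Lemma even_cardI_involution (X : finType) (f g : X -> X) (C B : {set X}) :
    {in C, forall x, [/\ f x \in C, f (f x) = x & f x != x]} ->
    {in C :\: B, forall x, [/\ g x \in C :\: B, g (g x) = x & g x != x]} ->
  ~~ odd #|C :&: B|.
Proof.
move=> fC gC; have := even_card_involution fC; rewrite -(cardsID B C) oddD.
by rewrite (negbTE (even_card_involution gC)) addbF.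
Qed.

Section Colourings.
Variable E : finType.
Implicit Types (G H : ribbon_graph E) (T A B : {set E}) (e f : E).
Implicit Types (x y z : aend E) (m : arrow E).

(** * Arrow ends and closed curves *)

Lemma label_along_edge x : label (along_edge x) = label x.
Proof. by case: x => [[e b] h]. Qed.

Lemma along_edge_neq x : along_edge x != x.
Proof. by case: x => [[e []] h]; apply/eqP=> -[]. Qed.

Lemma label_vls G x : (label (vls G x) \in edges G) = (label x \in edges G).
Proof.
by apply: negb_inj; rewrite -!vls_fix vlsK eq_sym.
Qed.

Lemma vls_neq G x : label x \in edges G -> vls G x != x.
Proof. by move=> xG; rewrite vls_fix xG. Qed.

(** [across] and [along_edge] generate a Klein four-group acting regularly on the four ends of an
    edge. *)
Lemma same_labelP x z :
    label z = label x ->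
  [\/ z = x, z = across x
    | z = along_edge x \/ z = across (along_edge x)].
Proof.
case: x z => [[e b] h] [[e' b'] h']; rewrite /label /= => <-.
by case: b; case: h; case: b'; case: h';
   do ?[by constructor 1 | by constructor 2 | by constructor 3; left
       | by constructor 3; right].
Qed.

Lemma mem_curve G s x : x \in curve G s x.
Proof. by rewrite inE connect0. Qed.

Lemma curve_closed G s (P : pred (aend E)) x y :
    (forall z, P z -> P (vls G z)) -> (forall z, P z -> P (s z)) ->
  P x -> y \in curve G s x -> P y.
Proof.
move=> Pv Ps Px; rewrite inE => /connectP[p].
elim: p x Px => [|z p IH] x Px /=; first by move=> _ ->.
by case/andP=> /orP[] /eqP ->; apply: IH; [apply: Pv | apply: Ps].
Qed.

Lemma curve_vls G s x : involutive s -> curve G s (vls G x) = curve G s x.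
Proof.
move=> sK; apply/setP=> y; rewrite !inE; apply: same_connect.
  apply: sym_connect_sym => u w /=.
  by rewrite -(can2_eq (@vlsK _ G) (@vlsK _ G)) -(can2_eq sK sK) ![_ == u]eq_sym.
by rewrite connect1 //= vlsK eqxx.
Qed.

Lemma curve_step G s x : involutive s -> curve G s (s x) = curve G s x.
Proof.
move=> sK; apply/setP=> y; rewrite !inE; apply: same_connect.
  apply: sym_connect_sym => u w /=.
  by rewrite -(can2_eq (@vlsK _ G) (@vlsK _ G)) -(can2_eq sK sK) ![_ == u]eq_sym.
by rewrite connect1 //= sK eqxx orbT.
Qed.

Lemma curve_eq G s x y : involutive s -> y \in curve G s x -> curve G s y = curve G s x.
Proof.
move=> sK yx; apply/eqP.
apply: (curve_closed (P := fun z => curve G s z == curve G s x)) yx => // z.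
  by rewrite curve_vls.
by rewrite curve_step.
Qed.

Lemma vertex_of_end G x : vertex_of G x.1 = inl (curve G (@across E) x).
Proof.
by case: x => m [] //; rewrite /vertex_of -(curve_step _ _ (@acrossK E)).
Qed.

(** * Alternating colourings *)

(** The two ends bound one edge line segment of [e]. For an edge of an alternating colouring, the
    other edge line segment gives the same value, its ends having the opposite colours. *)
Definition discrepancy (c : aend E -> bool) e : bool :=
  c (tail (e, false)) (+) c (head (e, true)).

Definition discrepancy_set G (c : aend E -> bool) : {set E} :=
  [set e in edges G | discrepancy c e].

Definition alternating G (c : aend E -> bool) : Prop :=
  (forall x, c (vls G x) = c x) /\
  (forall x, label x \in edges G -> c (across x) = ~~ c x).

Lemma alternating_along_edge G c x :
    alternating G c -> label x \in edges G ->
  c (along_edge x) = c x (+) discrepancy c (label x).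
Proof.
case=> _ ca; case: x => [[e b] h]; rewrite /label /= => eG.
have flip b' : c ((e, b'), true) = ~~ c ((e, b'), false) by rewrite -ca.
by rewrite /discrepancy /label /tail /head /=; case: b; case: h;
   rewrite /= !flip; do 2 case: (c _).
Qed.

(** Each arrow end gets the colour of the boundary component of the partial Petrial through it. For
    an edge in [A] the twist turns [along_edge] into [along_edge] followed by [across], so a colour
    constant along the new edge line segment changes along the old one. *)
Lemma colourable_petrial G A :
    A \subset edges G ->
  checkerboard_colourable (partial_petrial G A) <->
  exists2 c, alternating G c & discrepancy_set G c = A.
Proof.
move=> AG; set G' := partial_petrial G A; set p := @petrial_place E A.
have pK : involutive p := @petrial_placeK E A.
have vp x : vls G' (p x) = p (vls G x) by rewrite /= -/p pK.
have lp x : label (p x) = label x := label_petrial_place A x.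
have pa x : p (across x) = across (p x).
  by case: x => [[e b] h]; rewrite /p /petrial_place /=; case: ifP.
split=> [[black [_ neq]] | [c [cv ca] cA]].
  pose c' x := inl (curve G' (@along_edge E) x) \in black.
  have c'd y : c' (along_edge y) = c' y by rewrite /c' (curve_step _ _ (@along_edgeK E)).
  (* [across] takes an end of one edge line segment to an end of the other. *)
  have c'a x : label x \in edges G -> c' (across x) = ~~ c' x.
    case: x => [[e b] h]; rewrite /label /= => eG; have := neq e eG; rewrite /boundary_of -!/(c' _).
    have := c'd (head (e, false)); have := c'd (head (e, true)); rewrite /head /=.
    by case: b; case: h => /=; case: (c' (e, false, false));
      case: (c' (e, false, true)); case: (c' (e, true, false)); case: (c' (e, true, true)).
  exists (c' \o p); first split=> x /=.
  - by rewrite -vp /c' (curve_vls _ _ (@along_edgeK E)).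
  - by move=> xG; rewrite pa c'a ?lp.
  apply/setP=> e; rewrite inE; case: (boolP (e \in edges G)) => /= eG; last first.
    by apply/esym/negbTE; apply: contra eG; apply: (subsetP AG).
  rewrite /discrepancy /= /p /petrial_place /tail /head /= !andbF andbT.
  rewrite -(c'd ((e, false), false)) /=.
  case: ifP => _; last by rewrite addbb.
  by rewrite -[(e, true, false)]/(across (e, true, true)) c'a //; case: (c' _).
pose c' := c \o p; pose b := curve G' (@along_edge E).
have alt : alternating G c by [].
have c'v x : c' (vls G' x) = c' x by rewrite /c' /= -/p pK.
have c'a x : label x \in edges G -> c' (across x) = ~~ c' x.
  by move=> xG; rewrite /c' /= pa ca ?lp.
have c'd x : label x \in edges G -> c' (along_edge x) = c' x.
  case: x => [[e bb] h]; rewrite /label /= => eG; have /setP/(_ e) := cA.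
  rewrite inE eG /= => eA; rewrite /c' /=.
  have := @alternating_along_edge G c (e, bb, h) alt eG; rewrite /label /= eA /p /petrial_place => cd.
  have := ca (e, true, h) eG; have := ca (e, false, h) eG; rewrite /=.
  move: cd; case: bb; case: h => /=; case: (e \in A) => /=; case: (c (e, false, false));
    case: (c (e, false, true)); case: (c (e, true, false)); by case: (c (e, true, true)).
(* Constancy on boundary components makes the set [black] below well defined. *)
have cb x y : label x \in edges G -> y \in b x -> c' y = c' x.
  move=> xG yx.
  suff /andP[/eqP] : (c' y == c' x) && (label y \in edges G) by [].
  apply: (curve_closed (P := fun z => (c' z == c' x) && (label z \in edges G))) yx;
    last by rewrite eqxx xG.
  - by move=> z /andP[/eqP <- zG]; rewrite c'v eqxx (label_vls G').
  - by move=> z /andP[/eqP <- zG]; rewrite c'd // eqxx label_along_edge.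
pose black : {set {set aend E} + 'I_(blanks G)} :=
  [set inl (b x) | x : aend E & (label x \in edges G) && c' x].
have in_black x : label x \in edges G -> (inl (b x) \in black) = c' x.
  move=> xG; apply/imsetP/idP => [[y] | c'x]; last by exists x; rewrite ?inE ?xG.
  rewrite inE => /andP[yG c'y] [bxy].
  by rewrite (cb y x yG) // -bxy mem_curve.
exists black; split.
  apply/subsetP=> u /imsetP[x]; rewrite inE => /andP[xG _] ->.
  by rewrite inE; apply/orP; left; apply: imset_f; rewrite inE.
move=> e eG; rewrite /boundary_of !in_black //.
by rewrite -(c'd (head (e, false))) //= (c'a (head (e, true))) //; case: (c' _).
Qed.

(** If n steps from [x] led to [vls G x], then n - 2 steps from the next end would lead to its image
    under [vls G]; this descends to a fixed point of [vls G] or of [across]. *)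
Lemma vls_orientation G x :
  label x \in edges G -> ~~ fconnect (fun y => across (vls G y)) x (vls G x).
Proof.
set g := fun y => across (vls G y) => xG.
have gK y : vls G (across (g y)) = y by rewrite /g acrossK vlsK.
apply/negP=> /iter_findex; move: (findex _ _ _) => n; apply/eqP.
have [k] := ubnP n; elim: k n x xG => // k IH [|[|n]] x xG lt_nk.
- by rewrite eq_sym vls_neq.
- by rewrite /= across_neq.
rewrite iterSr iterS; apply: contra (IH n (g x) _ _) => [/eqP gx||].
- by have := congr1 (fun z => vls G (across z)) gx; rewrite /= gK => ->.
- by rewrite label_across label_vls.
- by rewrite -ltnS ltnW.
Qed.

Lemma curve_fconnect G x y :
    y \in curve G (@across E) x ->
  fconnect (fun y => across (vls G y)) x y ||
  fconnect (fun y => across (vls G y)) x (vls G y).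
Proof.
set g := fun y => across (vls G y).
have Kg z : g (vls G (across z)) = z by rewrite /g vlsK acrossK.
have g_inj : injective g.
  by move=> u z /(inv_inj (@acrossK E)) /(inv_inj (@vlsK E G)).
apply: (curve_closed (P := fun z => fconnect g x z || fconnect g x (vls G z))).
- by move=> z; rewrite vlsK orbC.
- move=> z /orP[xz | xvz]; apply/orP; [right | left].
    by apply: connect_trans xz _; rewrite fconnect_sym // -{2}[z]Kg fconnect1.
  by apply: connect_trans xvz _; rewrite -{2}[z](vlsK G) fconnect1.
- by rewrite connect0.
Qed.

(** The walk leaves each arrow of the circle exactly once, as leaving it at both ends would put both
    directions into one orbit. *)
Lemma degree_order G x :
    label x \in edges G ->
  degree (vertex_of G x.1) = order (fun y => across (vls G y)) x.
Proof.
set g := fun y => across (vls G y) => xG.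
have gK y : vls G (across (g y)) = y by rewrite /g acrossK vlsK.
have Kg y : g (vls G (across y)) = y by rewrite /g vlsK acrossK.
have g_inj : injective g.
  by move=> y z /(inv_inj (@acrossK E)) /(inv_inj (@vlsK E G)).
have labelg y : fconnect g x y -> label y \in edges G.
  move/iter_findex => <-; elim: (findex _ _ _) => //= n IH.
  by rewrite label_across label_vls.
have curveg y : fconnect g x y -> curve G (@across E) y = curve G (@across E) x.
  move/iter_findex => <-; elim: (findex _ _ _) => //= n IH.
  by rewrite curve_step ?curve_vls //; apply: acrossK.
have fst_inj : {in fconnect g x &, injective (@fst (arrow E) bool)}.
  move=> y z xy xz yz; have yG := labelg y xy.
  have [//|] : y = z \/ y = across z.
    by case: y z yz {xy xz yG} => [m []] [m' []] /= ->; [left|right|right|left].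
  move=> yaz; case/negP: (vls_orientation yG); apply: connect_trans (_ : fconnect g y z) _.
    by apply: connect_trans xz; rewrite fconnect_sym.
  by rewrite fconnect_sym // yaz -{2}[z]Kg fconnect1.
rewrite /order -(card_in_imset fst_inj); apply: eq_card => m; rewrite inE.
apply/andP/imsetP => [[mG /eqP mx] | [y xy ->]]; last first.
  split; first exact: labelg.
  by rewrite !vertex_of_end curveg.
have tx : tail m \in curve G (@across E) x.
  by move: mx; rewrite vertex_of_end => -[<-]; apply: mem_curve.
have := curve_fconnect tx; rewrite -/g.
case/orP=> xt; first by exists (tail m).
exists (across (tail m)) => //.
by apply: connect_trans xt _; rewrite -{2}[tail m](vlsK G) fconnect1.
Qed.

(* The orbits of [across \o vls] are the vertex boundaries with a direction;   *)
(* each has even length, and [clockwise] selects one of the two directions.    *)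
Lemma eulerian_alternating G : eulerian G -> exists c, alternating G c.
Proof.
move=> eulG; pose g y := across (vls G y).
have gK y : vls G (across (g y)) = y by rewrite /g acrossK vlsK.
have Kg y : g (vls G (across y)) = y by rewrite /g vlsK acrossK.
have g_inj : injective g.
  by move=> y z /(inv_inj (@acrossK E)) /(inv_inj (@vlsK E G)).
have csym := fconnect_sym g_inj.
have rootg y : froot g (g y) = froot g y.
  by apply/(rootP csym); rewrite csym fconnect1.
have gvg y : g (vls G (g y)) = vls G y by rewrite /g vlsK acrossK.
have rootvg y : froot g (vls G (g y)) = froot g (vls G y) by rewrite -(gvg y) rootg.
pose parity y := odd (findex g (froot g y) y).
have parityg y : label y \in edges G -> parity (g y) = ~~ parity y.
  move=> yG; rewrite /parity rootg; set r := froot g y.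
  have ry : fconnect g r y by rewrite csym connect_root.
  have rG : label r \in edges G.
    have : fconnect g y r by apply: connect_root.
    move/iter_findex => <-; elim: (findex _ _ _) => //= n IH.
    by rewrite label_across label_vls.
  have even_r : ~~ odd (order g r).
    rewrite -(degree_order rG); apply: eulG; rewrite inE vertex_of_end.
    by apply/orP; left; apply: imset_f; rewrite inE.
  rewrite -{1}(iter_findex ry) -iterS.
  (* The last position of the orbit is followed by the root, at position 0; the parity changes there
     because the order is even. *)
  have := findex_max ry; rewrite leq_eqVlt => /orP[/eqP eq_r | lt_r].
    by rewrite eq_r iter_order // findex0 -[odd (findex _ _ _)]negbK -oddS eq_r even_r.
  by rewrite findex_iter.
pose clockwise y := enum_rank (froot g y) < enum_rank (froot g (vls G y)).
have clockwise_vls y : label y \in edges G -> clockwise (vls G y) = ~~ clockwise y.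
  move=> yG; rewrite /clockwise vlsK -leqNgt [RHS]leq_eqVlt.
  case: eqP => // /val_inj/enum_rank_inj/(rootP csym).
  by rewrite csym (negbTE (vls_orientation yG)).
(* A vertex line segment takes the parity of its end in the selected orbit. *)
exists (fun y => parity (if clockwise y then y else vls G y)); split=> y.
  case: (boolP (label y \in edges G)) => yG; last by move: yG; rewrite -vls_fix => /eqP v_y; rewrite !v_y.
  by rewrite clockwise_vls // if_neg vlsK.
move=> yG; rewrite -[in across _](vlsK G y) -/(g (vls G y)).
have -> : clockwise (g (vls G y)) = ~~ clockwise y.
  by rewrite -clockwise_vls // /clockwise rootg rootvg.
rewrite if_neg; case: (clockwise y); last by rewrite parityg ?label_vls.
have yE : g (vls G (g (vls G y))) = y by rewrite gvg vlsK.
by rewrite -[in RHS]yE parityg ?negbK // label_vls label_across !label_vls.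
Qed.

(** * The two sides of a tree edge *)

Definition edge_step G T : rel ({set aend E} + 'I_(blanks G)) :=
  [rel u w | [exists m : arrow E,
    [&& m.1 \in T, vertex_of G m == u & target_of G m == w]]].
Arguments edge_step : clear implicits.

Lemma edge_step_sym G T : symmetric (edge_step G T).
Proof.
move=> u w; apply/existsP/existsP => -[[e b] /and3P[eT mu mw]];
  by exists (e, ~~ b); rewrite eT /target_of /= negbK mu mw.
Qed.

(** The edge of the first step cannot recur, since [u] would be an end of the later step and a
    simple path does not return to it. *)
Lemma edge_step_arrows G T u p :
    path (edge_step G T) u p -> uniq (u :: p) ->
  exists q : seq (arrow E), [/\ all (fun m => m.1 \in T) q,
    map (vertex_of G) q = belast u p, map (target_of G) q = p
    & uniq (map fst q)].
Proof.
elim: p u => [|w p IH] u /=; first by exists [::].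
case/andP=> /existsP[m /and3P[mT /eqP mu /eqP mw]] wp /andP[u_notin].
case/(IH w wp) => q [qT qv qt quniq]; exists (m :: q); split=> /=.
- by rewrite mT.
- by rewrite mu qv.
- by rewrite mw qt.
rewrite quniq andbT; apply: contra u_notin => /mapP[m' m'q mm'].
have [<- | <-] : vertex_of G m' = u \/ target_of G m' = u.
  case: m m' mm' mu {mT mw m'q} => [e b] [e' b'] /= <-.
  by case: b; case: b' => <-; [left | right | right | left].
- by apply: mem_belast; rewrite -qv map_f.
by rewrite inE -qt map_f ?orbT.
Qed.

Lemma path_target (G : ribbon_graph E) m q :
    map (target_of G) (belast m q) = map (vertex_of G) q ->
  path [rel m m' | target_of G m == vertex_of G m'] m q.
Proof.
by elim: q m => //= m' q IH m /eqP; rewrite eqseq_cons => /andP[-> /eqP/IH ->].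
Qed.

(** A simple path avoiding [e] between its ends would close up with [e] to a cycle; for a loop this
    path is empty. *)
Lemma tree_edge_separates G T e :
    (forall p : seq (arrow E), ~~ is_graph_cycle G T p) -> e \in T ->
  ~~ connect (edge_step G (T :\ e)) (vertex_of G (e, false)) (vertex_of G (e, true)).
Proof.
move=> acyclic eT; rewrite (sym_connect_sym (@edge_step_sym G _)).
apply/negP=> /connectP[p0 p0path].
case/shortenP: p0path => p ppath puniq _ p_last.
have [q [qT qv qt quniq]] := edge_step_arrows ppath puniq.
have vE : map (vertex_of G) (rcons q (e, false)) = vertex_of G (e, true) :: p.
  by rewrite map_rcons qv p_last -lastI.
apply/negP: (acyclic ((e, false) :: q)); rewrite negbK; apply/and5P; split=> //.
- rewrite /= eT; apply: sub_all qT => m; by rewrite inE => /andP[].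
- apply: path_target; rewrite belast_rcons vE /= qt.
  by [].
- rewrite /= quniq andbT; apply/mapP=> -[m mq em].
  by have := allP qT m mq; rewrite -em !inE eqxx.
by rewrite [map _ _]/= cons_uniq -rcons_uniq qv p_last -lastI.
Qed.

(** For [e] in an acyclic [T], adding this function to an alternating colouring keeps it alternating
    and, among edges of [T], changes the discrepancy of [e] only. *)
Definition tree_side G T e x : bool :=
  connect (edge_step G (T :\ e)) (vertex_of G (e, false)) (vertex_of G x.1).

Lemma tree_side_vls G T e x : tree_side G T e (vls G x) = tree_side G T e x.
Proof. by rewrite /tree_side !vertex_of_end curve_vls //; apply: acrossK. Qed.

Lemma tree_side_across G T e x : tree_side G T e (across x) = tree_side G T e x.
Proof. by case: x. Qed.

Lemma tree_side_along_edge G T e x :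
    (forall p : seq (arrow E), ~~ is_graph_cycle G T p) ->
    e \in T -> label x \in T ->
  tree_side G T e (along_edge x) = tree_side G T e x (+) (label x == e).
Proof.
move=> acyclic eT; case: x => [[f b] h]; rewrite /label /= => fT.
have sep := tree_edge_separates acyclic eT.
rewrite /tree_side /=; case: eqVneq => [-> | fe]; rewrite ?addbT ?addbF.
  by case: b; rewrite connect0 (negbTE sep).
have csym := sym_connect_sym (@edge_step_sym G (T :\ e)).
rewrite ![connect _ (vertex_of G (e, false)) _]csym; apply: same_connect => //.
apply: connect1; apply/existsP; exists (f, ~~ b).
by rewrite !inE fe fT /target_of /= negbK !eqxx.
Qed.

(** Induction along a path of [T]: [vls] and [across] spread [S] over a vertex, [along_edge] carries
    it to the next one. *)
Lemma spanning_closed G T (S : pred (aend E)) x y :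
    spanning_connected G T -> T \subset edges G ->
    (forall z, S z -> S (vls G z)) ->
    (forall z, S z -> S (across z)) ->
    (forall z, label z \in T -> S z -> S (along_edge z)) ->
  label x \in edges G -> label y \in edges G -> S x -> S y.
Proof.
move=> [_ conn] TG Sv Sa Sd xG yG Sx.
have in_vertices z : label z \in edges G -> inl (curve G (@across E) z) \in vertices G.
  by move=> zG; rewrite inE; apply/orP; left; apply: imset_f; rewrite inE.
have /connectP[p] := conn _ _ (in_vertices x xG) (in_vertices y yG).
have Scurve z z' : S z -> z' \in curve G (@across E) z -> S z'.
  by move=> Sz; apply: curve_closed.
elim: p x xG Sx => [|w p IH] x xG Sx /=.
  by move=> _ [yx]; apply: (Scurve x) => //; rewrite -yx mem_curve.
case/andP=> /existsP[m /and3P[mT /eqP mx /eqP mw]]; rewrite -mw.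
have Sm : S (tail m).
  by apply: (Scurve x) => //; case: mx => <-; apply: mem_curve.
have Sm' : S (tail (m.1, ~~ m.2)).
  by case: (m) mT Sm => e b eT Sm; rewrite -[tail _]acrossK; apply/Sa/(Sd (tail (e, b))).
by apply: IH => //; apply: (subsetP TG).
Qed.

(** * The single circles of the partial dual and of the contraction *)

(* The component C of x for vls and the steps of the partial dual other than   *)
(* those of e := label x is a path, hence contains an even number of ends of e; *)
(* as it stays on one side of e in the tree, these are x and across x.         *)
Lemma closed_across_tree G T (S : pred (aend E)) x :
    (forall p : seq (arrow E), ~~ is_graph_cycle G T p) -> T \subset edges G ->
    (forall z, S z -> S (vls G z)) ->
    (forall z, label z \notin T -> S z -> S (across z)) ->
    (forall z, label z \in T -> S z -> S (along_edge z)) ->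
  S x -> S (across x).
Proof.
move=> acyclic TG Sv Sa Sd Sx.
have [xT | xT] := boolP (label x \in T); last exact: Sa.
set e := label x in xT; have xG : label x \in edges G by apply: (subsetP TG).
pose pass z := if label z \in T then along_edge z else across z.
have label_pass z : label (pass z) = label z.
  by rewrite /pass; case: ifP; rewrite ?label_along_edge ?label_across.
have passK : involutive pass.
  move=> z; rewrite {1}/pass label_pass /pass.
  by case: ifP => zT; rewrite zT ?along_edgeK ?acrossK.
have pass_neq z : pass z != z.
  by rewrite /pass; case: ifP; rewrite ?along_edge_neq ?across_neq.
pose R := [rel y z | (z == vls G y) || (label y != e) && (z == pass y)].
have Rsym : symmetric R.
  move=> y z /=; rewrite -(can2_eq (@vlsK _ G) (@vlsK _ G)) [vls G z == y]eq_sym.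
  congr (_ || _); apply/andP/andP => -[ye /eqP ->]; by rewrite label_pass passK.
pose C := [set z | connect R x z].
have CP (P : pred (aend E)) z : P x -> (forall u, P u -> P (vls G u)) ->
    (forall u, label u != e -> P u -> P (pass u)) -> z \in C -> P z.
  move=> Px Pv Pp; rewrite inE => /connectP[p].
  elim: p (x) Px => [|w p IH] u Pu /=; first by move=> _ ->.
  by case/andP=> /orP[/eqP -> | /andP[ue /eqP ->]]; apply: IH; [apply: Pv | apply: Pp].
have CS z : z \in C -> S z.
  apply: CP => // u _ Su; rewrite /pass.
  by case: ifP => uT; [apply: Sd | apply: Sa; rewrite ?uT].
have C_side z : z \in C -> tree_side G T e z == tree_side G T e x.
  apply: (CP (fun z => tree_side G T e z == tree_side G T e x)) => // u.
    by rewrite tree_side_vls.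
  move=> ue /eqP <-; rewrite /pass; case: ifP => uT; last by rewrite tree_side_across.
  by rewrite tree_side_along_edge // (negbTE ue) addbF.
have CG z : z \in C -> label z \in edges G.
  by apply: (CP (fun z => label z \in edges G)) => // u; rewrite ?label_vls ?label_pass.
have xC : x \in C by rewrite inE.
(* Without [across x], the only end of [e] in [C] would be [x], against the evenness. *)
apply: CS; apply/negPn/negP => axC.
have: ~~ odd #|C :&: [set z | label z == e]|.
  apply: (@even_cardI_involution _ (vls G) pass) => z.
    move=> zC; split; [|exact: vlsK | by rewrite vls_neq ?CG].
    by move: zC; rewrite !inE => /connect_trans; apply; rewrite connect1 //= eqxx.
  rewrite !inE label_pass => /andP[ze zC]; rewrite ze; split=> //=.
  by apply: connect_trans zC _; rewrite connect1 //= ze eqxx orbT.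
suff -> : C :&: [set z | label z == e] = [set x] by rewrite cards1.
apply/setP=> z; rewrite !inE; apply/idP/eqP => [/andP[xz /eqP ze] | ->]; last first.
  by rewrite connect0 eqxx.
have zC : z \in C by rewrite inE.
have [// | zax | zd] := same_labelP (ze : label z = label x).
  by rewrite -zax zC in axC.
have := C_side z zC.
have -> : tree_side G T e z = tree_side G T e (along_edge x).
  by case: zd => ->; rewrite ?tree_side_across.
rewrite tree_side_along_edge // eqxx addbT.
by case: (tree_side _ _ _ _).
Qed.

Definition one_circle H : Prop :=
  forall x y, label x \in edges H -> label y \in edges H ->
  y \in curve H (@across E) x.

Lemma mem_curve_vls H s x y :
  involutive s -> (vls H y \in curve H s x) = (y \in curve H s x).
Proof.
move=> sK; apply/idP/idP => yx.
  by rewrite -(curve_eq sK yx) curve_vls // mem_curve.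
by rewrite -(curve_eq sK yx) -(curve_vls _ _ sK) mem_curve.
Qed.

Lemma mem_curve_step H s x y :
  involutive s -> (s y \in curve H s x) = (y \in curve H s x).
Proof.
move=> sK; apply/idP/idP => yx.
  by rewrite -(curve_eq sK yx) curve_step // mem_curve.
by rewrite -(curve_eq sK yx) -(curve_step _ _ sK) mem_curve.
Qed.

(** In the partial dual, the arrows with label in [T] lie along the edge line segments of the
    original graph. *)
Lemma dual_place_across T x :
  dual_place T (across x) =
    if label x \in T then along_edge (dual_place T x) else across (dual_place T x).
Proof.
by case: x => [[e b] h]; rewrite /label /=; case: ifP; case: h; rewrite /= ?negbK.
Qed.

(** By [closed_across_tree], the ends on a circle of the dual are closed under [across] on [T] too,
    so connectedness of [T] yields all ends. *)
Lemma one_circle_dual G T : spanning_tree G T -> one_circle (partial_dual G T).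
Proof.
case=> TG conn acyclic x y xG yG; set H := partial_dual G T; set a := @across E.
pose f := @dual_place E T; pose g := @dual_unplace E T.
have fg : cancel f g := @dual_placeK E T.
have gf : cancel g f := @dual_unplaceK E T.
have labelf z : label (f z) = label z := label_dual_place T z.
have labelg z : label (g z) = label z by rewrite -labelf gf.
(* In the ends of G, the circle of H follows across off T and along_edge on T. *)
pose S z := g z \in curve H a x.
have Sv z : S z -> S (vls G z).
  by rewrite /S -(mem_curve_vls _ _ _ (@acrossK E)) /= -/f -/g gf.
have Sa z : label z \notin T -> S z -> S (across z).
  move=> zT; rewrite /S -(mem_curve_step _ _ _ (@acrossK E)) => Sz.
  rewrite [g _](_ : _ = across (g z)) //.
  by rewrite -[RHS]fg /f dual_place_across labelg (negbTE zT) -/f gf.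
have Sd z : label z \in T -> S z -> S (along_edge z).
  move=> zT; rewrite /S -(mem_curve_step _ _ _ (@acrossK E)) => Sz.
  rewrite [g _](_ : _ = across (g z)) //.
  by rewrite -[RHS]fg /f dual_place_across labelg zT -/f gf.
have -> : y = g (f y) by rewrite fg.
apply: (spanning_closed (S := S) (x := f x) conn TG) => //; rewrite ?labelf //.
  by move=> z; apply: (closed_across_tree acyclic TG).
by rewrite /S fg mem_curve.
Qed.

Lemma skip_id H T x : label x \notin T -> skip H T x = x.
Proof. by rewrite /skip => /negbTE ->. Qed.

Lemma iter_skip_id H T n x : label x \notin T -> iter n (skip H T) x = x.
Proof. by move=> xT; elim: n => //= n ->; apply: skip_id. Qed.

(** Each end on the circle of [H] is projected to the remaining end at which skipping stops;
    neighbours project into one circle of [K]. *)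
Lemma one_circle_delete H T : one_circle H -> one_circle (delete H T).
Proof.
set K := delete H T => circleH x y xK yK.
set S := curve K (@across E) x; set exit := iter #|aend E| (skip H T).
have edgesK z : (label z \in edges K) = (label z \notin T) && (label z \in edges H).
  by rewrite !inE.
have S_edges z : z \in S -> label z \in edges K.
  apply: (curve_closed (P := fun u => label u \in edges K)) => // u.
    by rewrite label_vls.
  by rewrite label_across.
have S_notT z : z \in S -> label z \notin T by move/S_edges; rewrite edgesK => /andP[].
have Sv z : (vls K z \in S) = (z \in S) := mem_curve_vls K x z (@acrossK E).
have Sa z : (across z \in S) = (z \in S) := mem_curve_step K x z (@acrossK E).
have vlsKE z : label z \notin T -> vls K z = exit (vls H z).
  by rewrite /= /delete_vls => /negbTE ->.
have exit_skip z : exit z \in S -> exit (skip H T z) = exit z.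
  by move=> zS; rewrite /exit -iterSr iterS skip_id // S_notT.
(* From the two ends of an erased arrow one skips in opposite directions, to the two ends of one
   merged vertex line segment. *)
have exit_across n z : iter n (skip H T) z \in S -> exit (across z) \in S.
  elim: n z => [|n IH] z.
    by move=> zS; rewrite /exit iter_skip_id ?label_across ?S_notT // Sa.
  rewrite iterSr; have [zT | zT] := boolP (label z \in T); last by rewrite skip_id // => /IH.
  set u := skip H T z => uS; have auS := IH u uS.
  have uE : vls H u = across z by rewrite /u /skip zT vlsK.
  have [uT | uT] := boolP (label u \in T).
    by move: (auS); rewrite -exit_skip // {1}/skip label_across uT acrossK uE.
  by rewrite -uE -vlsKE // Sv; move: uS; rewrite iter_skip_id.
have xT : label x \notin T by move: xK; rewrite edgesK => /andP[].
have yT : label y \notin T by move: yK; rewrite edgesK => /andP[].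
have xH : label x \in edges H by move: xK; rewrite edgesK => /andP[].
have yH : label y \in edges H by move: yK; rewrite edgesK => /andP[].
have := circleH x y xH yH.
have -> : (y \in S) = (exit y \in S) by rewrite /exit iter_skip_id.
apply: (curve_closed (P := fun z => exit z \in S)) => [z zS | z |].
- have [zT | zT] := boolP (label z \in T); last first.
    by rewrite -vlsKE // Sv; move: zS; rewrite /exit iter_skip_id.
  have := exit_across _ z zS => azS; move: (azS); rewrite -exit_skip //.
  by rewrite {1}/skip label_across zT acrossK.
- exact: exit_across.
by rewrite /exit iter_skip_id // mem_curve.
Qed.

(** * Indices and adjoint sets *)

(** The colour changes exactly at the arrows passed. Meeting i + 1 segments means passing i arrows,
    so an odd count means equal colours. *)
Lemma index_tE H c e :
    one_circle H -> alternating H c -> e \in edges H ->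
  (index_t H e == 1) = discrepancy c e.
Proof.
move=> circleH [cv ca] eH; rewrite /index_t /segments_met /walk.
set g := fun y => across (vls H y); set x := head (e, true); set t := tail (e, false).
set p := (fun y => _); set O := orbit g x; set i := find p O.
have hasp : has p O.
  have /curve_fconnect : t \in curve H (@across E) x by apply: circleH.
  rewrite !fconnect_orbit -/g -/O => /orP[tO | tO]; apply/hasP.
    by exists t; rewrite // /p eqxx.
  by exists (vls H t); rewrite // /p vlsK eqxx orbT.
have lt_i : i < order g x by rewrite -size_orbit -has_find.
have := nth_find x hasp; rewrite -/i /O /orbit nth_traject // => pi.
have [xE cE] : label (iter i g x) \in edges H /\ c (iter i g x) = c x (+) odd i.
  elim: (i) => [|n [nE cn]] /=; first by rewrite addbF.
  by rewrite label_across label_vls nE ca ?label_vls // cv cn addbN.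
have ct : c t = c x (+) odd i.
  by rewrite -cE; case/orP: pi => /eqP <-; rewrite ?cv.
rewrite /discrepancy -/t -/x ct /=; case: (odd i); by case: (c x).
Qed.

(** As [k] changes exactly at the arrows of [e], its two values distinguish the two arcs. *)
Lemma arc_arrowsE H (k : aend E -> bool) e f h b :
    one_circle H -> e \in edges H -> f \in edges H -> f != e ->
    (forall x, k (vls H x) = k x) ->
    (forall x, label x \in edges H -> k (across x) = k x (+) (label x == e)) ->
  ((f, b) \in arc_arrows H e h) = (k ((f, b), false) == k ((e, true), h)).
Proof.
move=> circleH eH fH fe kv ka; rewrite /arc_arrows /walk.
set g := fun y => across (vls H y); set x := ((e, true), h).
set w := behead (orbit g x); set j := find _ w.
have wE : w = traject g (g x) (order g x).-1 by rewrite /w /orbit -orderSpred.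
have nth_w i : i < (order g x).-1 -> nth x w i = iter i.+1 g x.
  by move=> lt_i; rewrite /w nth_behead nth_traject // -ltn_predRL.
have le_j : j <= (order g x).-1.
  by apply: leq_trans (find_size _ _) _; rewrite wE size_traject.
rewrite wE take_traject //.
have label_iter i : label (iter i g x) \in edges H.
  by elim: i => //= i IH; rewrite label_across label_vls.
have inner i : 0 < i <= j -> label (iter i g x) != e.
  case: i => // i /= lt_ij; have := before_find x lt_ij.
  by rewrite nth_w ?(leq_trans lt_ij) // => ->.
(* If the search fails, the walk has returned to [x], itself labelled [e]. *)
have outer : label (iter j.+1 g x) = e.
  have [has_e | no_e] := boolP (has (fun y => label y == e) w).
    have := nth_find x has_e; rewrite -/j nth_w; first by move/eqP.
    by move: has_e; rewrite has_find -/j wE size_traject.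
  have -> : j.+1 = order g x.
    by rewrite /j (hasNfind no_e) wE size_traject orderSpred.
  by rewrite iter_order // => u z /(inv_inj (@acrossK E)) /(inv_inj (@vlsK E H)).
have k_iter i : i <= j -> k (iter i g x) = k x.
  elim: i => // i IH lt_ij; rewrite iterS {1}/g ka ?label_vls // kv IH ?(ltnW lt_ij) //.
  by have := inner i.+1 lt_ij; rewrite iterS {1}/g label_across => /negbTE ->; rewrite addbF.
(* Q is the arc leaving x, as a set of ends. It contains two ends of e, namely *)
(* x and the other one with the colour of x, so by connectedness it contains   *)
(* all ends of that colour.                                                    *)
pose s := traject g x j.+1.
pose Q y := (y \in s) || (vls H y \in s).
have sP y : reflect (exists2 i, i < j.+1 & y = iter i g x) (y \in s) by apply: trajectP.
have Qx : Q x by rewrite /Q inE eqxx.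
have Qv y : Q (vls H y) = Q y by rewrite /Q vlsK orbC.
have Q_edges y : Q y -> label y \in edges H.
  by case/orP=> /sP[i _ yi]; [rewrite yi | rewrite -label_vls yi]; apply: label_iter.
have kQ y : Q y -> k y = k x.
  by case/orP=> /sP[i le_ij yi]; [rewrite yi | rewrite -kv yi]; apply: k_iter.
have Q_across y : label y != e -> vls H y \in s -> across y \in s.
  move=> ye /sP[i le_ij yi]; apply/sP; exists i.+1; last first.
    by rewrite iterS -yi /g vlsK.
  rewrite ltnS ltn_neqAle -ltnS le_ij andbT; apply: contra_neq ye => ij.
  by rewrite -outer -ij iterS -yi /g vlsK label_across.
have Qa y : label y != e -> Q y -> Q (across y).
  move=> ye /orP[/sP[[|i] le_ij yi] | vy]; last by rewrite /Q Q_across.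
    by rewrite yi eqxx in ye.
  apply/orP; right; apply/sP; exists i; first exact: ltnW.
  by rewrite yi iterS /g acrossK vlsK.
have kx : k (across x) = ~~ k x by rewrite ka // eqxx addbT.
have [x' [x'e Qx' x'_neq]] : exists x', [/\ label x' = e, Q x' & x' != x].
  have: ~~ odd #|[set y | Q y] :&: [set y | label y == e]|.
    apply: (@even_cardI_involution _ (vls H) (@across E)) => y; rewrite !inE.
      by move=> Qy; rewrite Qv vls_neq ?Q_edges ?vlsK.
    by case/andP=> ye Qy; rewrite label_across ye Qa // acrossK across_neq.
  rewrite (cardsD1 x) !inE Qx eqxx /= negbK => /odd_gt0/card_gt0P[y].
  by rewrite !inE => /and3P[y_neq Qy /eqP ye]; exists y.
have Qe y : label y = e -> k y = k x -> Q y.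
  have k_neq u : label u = e -> k (across u) <> k u.
    by move=> ue; rewrite ka ue ?eqxx //; case: (k u).
  have kx' := kQ _ Qx'.
  have xe : label x = e by [].
  move=> ye ky; have [-> // | yx | yd] := same_labelP (etrans ye (esym xe)).
    by case: (k_neq x xe); rewrite -yx.
  have [x'x | x'x | x'd] := same_labelP (etrans x'e (esym xe)).
  - by rewrite x'x eqxx in x'_neq.
  - by case: (k_neq x xe); rewrite -x'x.
  have [-> // | yx'] : y = x' \/ y = across x'.
    by case: yd => ->; case: x'd => ->; rewrite ?acrossK; [left|right|right|left].
  by case: (k_neq x' x'e); rewrite -yx' ky.
(* Ends of the colour of [x] outside [Q] are not labelled [e], so they form a set closed along the
   circle, which would then contain [x]. *)
have Qk y : label y \in edges H -> k y = k x -> Q y.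
  move=> yH ky; apply: contraT => nQy.
  suff /and3P[_ /negP] : [&& label x \in edges H, ~~ Q x & k x == k x] by [].
  apply: (curve_closed (P := fun z => [&& label z \in edges H, ~~ Q z & k z == k x])) (circleH y x yH eH).
  - by move=> z; rewrite label_vls Qv kv.
  - move=> z /and3P[zH nQz /eqP kz]; rewrite label_across zH /=.
    have ze : label z != e by apply: contra nQz => /eqP ze; rewrite Qe.
    rewrite ka // (negbTE ze) addbF kz eqxx andbT.
    by apply: contra nQz => /Qa; rewrite label_across acrossK; apply.
  - by rewrite yH nQy ky eqxx.
have sE : s = x :: traject g (g x) j by [].
have in_t z : label z = f -> z \in s -> z \in traject g (g x) j.
  move=> zf; rewrite sE inE => /orP[/eqP zx | //].
  by move: fe; rewrite -zf zx eqxx.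
apply/mapP/eqP => [[y yt yf] | kf].
  have ky : k y = k x by apply: kQ; rewrite /Q sE inE yt orbT.
  have yl : label y = f by rewrite /label -yf.
  case: y yf yl ky {yt} => m [] /= <- yl ky //.
  by rewrite -ky (ka ((f, b), false) fH) [label _ == e](negbTE fe) addbF.
set z := ((f, b), false).
have /orP[zs | vzs] := Qk z fH kf.
  by exists z => //; apply: in_t.
by exists (across z) => //; apply: in_t => //; apply: Q_across.
Qed.

(** Carried to the partial dual, the side of the tree edge changes exactly at the arrows of [e]. So
    each arc is one side, and both arcs give the same set. *)
Lemma adjoint_setE G T e h :
    spanning_tree G T -> e \in T ->
  adjoint_set G T h e = discrepancy_set G (tree_side G T e).
Proof.
move=> treeT eT; have [TG _ acyclic] := treeT; set H := partial_dual G T.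
pose chi := tree_side G T e; pose k := chi \o @dual_place E T.
have eG : e \in edges G by apply: (subsetP TG).
have kv x : k (vls H x) = k x.
  by rewrite /k /= dual_unplaceK /chi tree_side_vls.
have ka x : label x \in edges H -> k (across x) = k x (+) (label x == e).
  move=> _; rewrite /k /= dual_place_across; case: ifP => xT.
    by rewrite /chi tree_side_along_edge // label_dual_place.
  rewrite /chi tree_side_across; case: eqP => [xe | _]; last by rewrite addbF.
  by rewrite xe eT in xT.
apply/setP=> f; rewrite in_setU1 !inE.
have [fT | fT] := boolP (f \in T).
  rewrite /= orbF /discrepancy.
  have := tree_side_along_edge (x := tail (f, false)) acyclic eT fT.
  rewrite /= => ->; rewrite addbA addbb /= /label /=.
  by rewrite (subsetP TG f fT).
have fe : f != e by apply: contraNneq fT => ->.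
rewrite (negbTE fe) /=; case: (boolP (f \in edges G)) => //= fG.
have circleH := one_circle_dual treeT.
rewrite !(arc_arrowsE h _ circleH eG fG fe kv ka).
have -> : k (f, true, false) = chi (head (f, true)).
  rewrite -[head _]/(across (tail (f, true))) /chi tree_side_across.
  by rewrite /k /= (negbTE fT).
rewrite /k /= (negbTE fT) /discrepancy -/(tail (f, false)) -/chi.
by case: (chi (tail _)); case: (chi (head _)); case: (chi _).
Qed.

(** [c] does not change along the edge line segments of tree edges, which are the arrows erased in
    the contraction, so it still alternates there. *)
Lemma index_one_setE G T c :
    spanning_tree G T -> alternating G c ->
    {in T, forall e, discrepancy c e = false} ->
  index_one_set G T = discrepancy_set G c.
Proof.
move=> treeT altc cT; have [TG _ _] := treeT; have [cv ca] := altc.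
set H := partial_dual G T; pose k := c \o @dual_place E T.
have kv x : k (vls H x) = k x by rewrite /k /= dual_unplaceK cv.
have ka x : label x \in edges G -> k (across x) = k x (+) (label x \notin T).
  move=> xG; rewrite /k /= dual_place_across; case: ifP => xT /=.
    by rewrite (alternating_along_edge altc) label_dual_place ?xG // cT.
  by rewrite ca ?label_dual_place // addbT.
have k_skip x : k (skip H T x) = k x.
  rewrite /skip; case: ifP => xT //.
  by rewrite kv ka ?xT ?addbF // (subsetP TG).
have altk : alternating (contraction G T) k.
  split=> x.
    rewrite /= /delete_vls; case: ifP => // _; rewrite -[RHS]kv.
    by elim: #|_| => //= n <-; rewrite k_skip.
  by rewrite inE => /andP[xT xG]; rewrite ka // xT addbT.
have circleK := one_circle_delete (T := T) (one_circle_dual treeT).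
apply/setP=> e; rewrite !inE; have [eT | eT] := boolP (e \in T).
  by rewrite cT // andbF.
case: (boolP (e \in edges G)) => //= eG.
rewrite (index_tE circleK altk) ?inE ?eT //.
by rewrite /discrepancy /k /= (negbTE eT).
Qed.

(** * Colourings with prescribed trace on the tree *)

Lemma alternating_tree_sides G T c B :
    alternating G c ->
  alternating G (fun x => c x (+) \big[addb/false]_(e in B) tree_side G T e x).
Proof.
case=> cv ca; split=> x.
  by rewrite cv; congr (_ (+) _); apply: eq_bigr => e _; rewrite tree_side_vls.
move=> xG; rewrite ca // addNb; congr (~~ (_ (+) _)).
by apply: eq_bigr => e _; rewrite tree_side_across.
Qed.

Lemma discrepancy_tree_sides G T c B e :
  discrepancy (fun x => c x (+) \big[addb/false]_(e' in B) tree_side G T e' x) e =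
  discrepancy c e (+) \big[addb/false]_(e' in B) discrepancy (tree_side G T e') e.
Proof. by rewrite /discrepancy big_split /= addbACA. Qed.

Lemma discrepancy_tree_side G T e f :
    (forall p : seq (arrow E), ~~ is_graph_cycle G T p) -> e \in T -> f \in T ->
  discrepancy (tree_side G T e) f = (f == e).
Proof.
move=> acyclic eT fT; rewrite /discrepancy.
have := tree_side_along_edge (x := tail (f, false)) acyclic eT fT.
by rewrite /= => ->; rewrite addbA addbb.
Qed.

Lemma big_addb_eq B e : \big[addb/false]_(e' in B) (e == e') = (e \in B).
Proof.
case: (boolP (e \in B)) => eB; last first.
  by rewrite big1 // => e' e'B; apply: contraNF eB => /eqP ->.
rewrite (bigD1 e) //= eqxx big1 // => e' /andP[_ /negbTE].
by rewrite eq_sym.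
Qed.

(* Two alternating colourings differ by a two-colouring of the vertices, which *)
(* is constant once it does not change along the edges of T.                   *)
Lemma discrepancy_set_inj G T c c' :
    spanning_tree G T -> alternating G c -> alternating G c' ->
    {in T, discrepancy c =1 discrepancy c'} ->
  discrepancy_set G c = discrepancy_set G c'.
Proof.
move=> [TG conn _] altc altc' ecc'; have [cv ca] := altc; have [cv' ca'] := altc'.
apply/setP=> e; rewrite !inE; case: (boolP (e \in edges G)) => //= eG.
pose x := tail (e, false); pose y := head (e, true).
suff /andP[_ /eqP] : (label y \in edges G) && (c y (+) c' y == c x (+) c' x).
  rewrite /discrepancy -/x -/y; case: (c x); case: (c y); by case: (c' x); case: (c' y).
pose S z := (label z \in edges G) && (c z (+) c' z == c x (+) c' x).
apply: (spanning_closed (S := S) (x := x) conn TG) => //; last by rewrite /S eqxx andbT.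
- by move=> z; rewrite /S label_vls cv cv'.
- by move=> z /andP[zG]; rewrite /S label_across ca // ca' // addNb addbN negbK zG.
move=> z zT /andP[zG]; rewrite /S label_along_edge zG /=.
by rewrite !(alternating_along_edge _ zG) // ecc' // addbACA addbb addbF.
Qed.

End Colourings.

Theorem theorem4p6 (E : finType) (G : ribbon_graph E) (T A : {set E})
    (side : E -> bool) :
  eulerian G -> spanning_tree G T -> A \subset edges G ->
  (checkerboard_colourable (partial_petrial G A) <->
   A = symdiff (index_one_set G T)
         (\big[@symdiff E/set0]_(e in A :&: T) adjoint_set G T (side e) e)).
Proof.
move=> eulG treeT AG; have [TG _ acyclic] := treeT.
have [c0 alt0] := eulerian_alternating eulG.
have disc_big c (B : {set E}) : B \subset T -> {in T, forall f,
    discrepancy (fun x => c x (+) \big[addb/false]_(e in B) tree_side G T e x) f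
      = discrepancy c f (+) (f \in B)}.
  move=> BT f fT; rewrite (discrepancy_tree_sides G T c B f) -[in RHS]big_addb_eq.
  congr (_ (+) _); apply: eq_bigr => e eB.
  by rewrite discrepancy_tree_side // (subsetP BT).
(* Adding the sides of these edges cancels the trace of [c0] on [T]. *)
pose B0 := T :&: discrepancy_set G c0.
pose c1 x := c0 x (+) \big[addb/false]_(e in B0) tree_side G T e x.
have alt1 : alternating G c1 by apply: alternating_tree_sides.
have c1T : {in T, forall e, discrepancy c1 e = false}.
  move=> e eT; rewrite disc_big ?subsetIl // !inE eT (subsetP TG) //=.
  exact: addbb.
(* This colouring has trace [A :&: T] on [T]. *)
pose cA x := c1 x (+) \big[addb/false]_(e in A :&: T) tree_side G T e x.
have altA : alternating G cA by apply: alternating_tree_sides.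
(* Discrepancies add up: [c1] contributes the index set and each tree side an adjoint set. *)
have -> : symdiff (index_one_set G T)
    (\big[@symdiff E/set0]_(e in A :&: T) adjoint_set G T (side e) e)
    = discrepancy_set G cA.
  apply/setP=> f; rewrite in_symdiff (index_one_setE treeT alt1 c1T).
  rewrite (big_morph (fun S : {set E} => f \in S) (fun S S' => in_symdiff S S' f) (in_set0 f)).
  under eq_bigr => e /setIP[_ eT] do rewrite (adjoint_setE _ treeT eT) inE.
  rewrite !inE (discrepancy_tree_sides G T c1 (A :&: T) f).
  by case: (f \in edges G) => //=; rewrite big1.
split=> [/(colourable_petrial AG)[c altc cE] | AE].
  (* [c] and [cA] have the same trace on [T], which determines the whole set. *)
  rewrite -{1}cE; apply: (discrepancy_set_inj treeT) => // e eT.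
  rewrite disc_big ?subsetIr // c1T // inE eT andbT -cE inE.
  by rewrite (subsetP TG).
by apply/(colourable_petrial AG); exists cA.
Qed.
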